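(* Let $(N,[\cdot,\cdots,\cdot],\alpha)$ be a multiplicative $n$-Hom Lie superalgebra over a field $\mathbb{F}$ of characteristic zero. Let $\breve{N}=Nt+Nt^{n}$ be the multiplicative $n$-Hom Lie superalgebra (with twisting map $\breve\alpha$) defined in the context. Let $U$ be a $\mathbb{Z}_2$-graded subspace of $N$ with $N=U\oplus[N,\cdots,N]$, so that $\breve N=Nt+Ut^{n}+[N,\cdots,N]t^{n}$. Let $\varphi:QDer(N)\to End(\breve N)$ be the map given by $$\varphi(D)(at+ut^{n}+bt^{n})=D(a)t+D'(b)t^{n}\qquad (a\in N,\ u\in U,\ b\in[N,\cdots,N]),$$ where $D'$ is a linear map associated with the quasiderivation $D$ as in the definition of quasiderivation. Then: (1) $|\varphi|=0$, i.e. $\varphi$ is an even map; (2) $\varphi$ is injective and $\varphi(D)$ does not depend on the choice of $D'$; (3) $\varphi(QDer(N))\subseteq Der(\breve{N})$.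
   Context: Let $n\ge 2$, $J=\{1,\dots,n\}$, and let $\mathbb{N}$ be the non-negative integers. For a $\mathbb{Z}_2$-graded space, $|x|$ denotes the degree of a homogeneous element $x$; $x$ is assumed homogeneous whenever $|x|$ occurs. Put $|X_i|=|x_1|+\cdots+|x_i|$, $|X_0|=0$, and similarly $|Y_i|$. $End_\xi(N)$ denotes the linear maps $N\to N$ homogeneous of degree $\xi\in\mathbb{Z}_2$. A multiplicative $n$-Hom Lie superalgebra $(N,[\cdot,\cdots,\cdot],\alpha)$ is a $\mathbb{Z}_2$-graded vector space $N=N_{\bar0}\oplus N_{\bar1}$ with an $n$-linear bracket $N^{n}\to N$ and an even linear map $\alpha:N\to N$ such that, for homogeneous elements: $|[x_1,\dots,x_n]|=|X_n|$; $[x_1,\dots,x_i,x_{i+1},\dots,x_n]=-(-1)^{|x_i||x_{i+1}|}[x_1,\dots,x_{i+1},x_i,\dots,x_n]$; $\alpha([x_1,\dots,x_n])=[\alpha(x_1),\dots,\alpha(x_n)]$; and $$[\alpha(x_1),\dots,\alpha(x_{n-1}),[y_1,\dots,y_n]]=\sum_{i=1}^n(-1)^{|X_{n-1}||Y_{i-1}|}[\alpha(y_1),\dots,\alpha(y_{i-1}),[x_1,\dots,x_{n-1},y_i],\alpha(y_{i+1}),\dots,\alpha(y_n)].$$ $[N,\cdots,N]$ denotes the span of all brackets. For $k\in\mathbb{N}$: - $D\in End_\xi(N)$ is an $\alpha^k$-derivation if $D\alpha=\alpha D$ and $D([x_1,\dots,x_n])=\sum_{i=1}^n(-1)^{\xi|X_{i-1}|}[\alpha^k(x_1),\dots,\alpha^k(x_{i-1}),D(x_i),\alpha^k(x_{i+1}),\dots,\alpha^k(x_n)]$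 for all homogeneous $x_i$. - $D\in End_\xi(N)$ is an $\alpha^k$-quasiderivation if $D\alpha=\alpha D$ and there is $D'\in End_\xi(N)$ with $D'\alpha=\alpha D'$ and $\sum_{i=1}^n(-1)^{\xi|X_{i-1}|}[\alpha^k(x_1),\dots,\alpha^k(x_{i-1}),D(x_i),\alpha^k(x_{i+1}),\dots,\alpha^k(x_n)]=D'([x_1,\dots,x_n])$ for all homogeneous $x_i$; such a $D'$ is the map associated with $D$. $Der_{\alpha^k}(N)$, $QDer_{\alpha^k}(N)$ denote the spans of these homogeneous maps, and $Der(N)=\sum_{k\ge0}Der_{\alpha^k}(N)$, $QDer(N)=\sum_{k\ge0}QDer_{\alpha^k}(N)$. The same definitions apply to $(\breve N,[\cdot,\cdots,\cdot],\breve\alpha)$. The algebra $\breve N$: let $t$ be an indeterminate and write $xt^j$ for $x\otimes t^j$. $\breve N=\{\sum(x\otimes t+y\otimes t^n)\mid x,y\in N\}$, with $|x\otimes t^j|=|x|$, $\breve\alpha(x\otimes t+y\otimes t^n)=\alpha(x)\otimes t+\alpha(y)\otimes t^n$, and bracket $[x_1\otimes t^{j_1},\dots,x_n\otimes t^{j_n}]=[x_1,\dots,x_n]\otimes t^{j_1+\cdots+j_n}$ for $j_k\in\{1,n\}$, with the convention that $t^m=0$ for $m\ge n+1$.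
   Formalization: In (3), α(U)⊆U is assumed (without it φ(id) does not commute with the twisting map). As D' depends on k, φ is taken on decompositions D=ΣD_k with D_k in QDer_{α^k}(N), D'=ΣD'_k; evenness is for homogeneous D_k, and injectivity means φ determines D. *)

(* Defs.v *)
From HB Require Import structures.
From mathcomp Require Import all_boot all_order all_algebra perm.

Set Implicit Arguments.
Unset Strict Implicit.
Unset Printing Implicit Defensive.
Import GRing.Theory.
Local Open Scope ring_scope.

(* Conventions: Z_2 is [bool] (false = even, true = odd, sum = addb, product =
   andb), and the n arguments x_1, ..., x_n of a bracket are indexed from 0 by
   'I_n. *)

Notation End V := {linear V -> V}.

(* |x_1| + ... + |x_{i-1}| for the argument number i (numbered from 0 here). *)
Definition degpre n (d : 'I_n -> bool) (i : nat) : bool :=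
  \big[addb/false]_(j < n | (j < i)%N) d j.

Definition degtot n (d : 'I_n -> bool) : bool := \big[addb/false]_j d j.

Section Args.
Variables (V : Type) (n : nat).

Definition upd (x : {ffun 'I_n -> V}) (i : 'I_n) (v : V) : {ffun 'I_n -> V} :=
  [ffun j => if j == i then v else x j].

Definition swap (x : {ffun 'I_n -> V}) (i j : 'I_n) : {ffun 'I_n -> V} :=
  [ffun l => x (tperm i j l)].

(* (x_1, ..., x_{n-1}, z) *)
Definition snoc (x : {ffun 'I_n.-1 -> V}) (z : V) : {ffun 'I_n -> V} :=
  [ffun i : 'I_n => oapp x z (insub (val i))].

(* (f x_1, ..., f x_{i-1}, v, f x_{i+1}, ..., f x_n) *)
Definition around (f : V -> V) (x : {ffun 'I_n -> V}) (i : 'I_n) (v : V) :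
  {ffun 'I_n -> V} := [ffun j => if j == i then v else f (x j)].

End Args.

Section Graded.
Variables (F : fieldType) (V : lmodType F).
Implicit Types (gr : bool -> {pred V}) (U : {pred V}).

Definition is_grading gr : Prop :=
  [/\ forall b, submod_closed (gr b),
      forall x, exists x0 x1,
        [/\ x0 \in gr false, x1 \in gr true & x = x0 + x1]
    & forall x, x \in gr false -> x \in gr true -> x = 0].

Definition graded_subspace gr U : Prop :=
  submod_closed U /\
  (forall x, x \in U -> exists x0 x1,
     [/\ x0 \in gr false, x1 \in gr true, x0 \in U, x1 \in U & x = x0 + x1]).

Definition homog gr (xi : bool) (f : V -> V) : Prop :=
  forall b x, x \in gr b -> f x \in gr (xi (+) b).

End Graded.

Record nHomLieSuper (F : fieldType) (n : nat) := NHomLieSuper {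
  carrier :> lmodType F;
  gr : bool -> {pred carrier};
  br : {ffun 'I_n -> carrier} -> carrier;
  alpha : End carrier;
  arity_ge2 : (2 <= n)%N;
  gr_grading : is_grading gr;
  br_linear : forall x i (a : F) u v,
    br (upd x i (a *: u + v)) = a *: br (upd x i u) + br (upd x i v);
  alpha_even : homog gr false alpha;
  br_gr : forall (x : {ffun 'I_n -> carrier}) d, (forall i, x i \in gr (d i)) -> br x \in gr (degtot d);
  br_skew : forall (x : {ffun 'I_n -> carrier}) d (i j : 'I_n), (forall l, x l \in gr (d l)) ->
    j = i.+1 :> nat ->
    br x = - ((-1) ^+ (d i && d j) *: br (swap x i j));
  alpha_br : forall x : {ffun 'I_n -> carrier}, alpha (br x) = br [ffun i => alpha (x i)];
  hom_jacobi : forall (x : {ffun 'I_n.-1 -> carrier}) (y : {ffun 'I_n -> carrier})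
      (d : 'I_n.-1 -> bool) (e : 'I_n -> bool),
    (forall i, x i \in gr (d i)) -> (forall i, y i \in gr (e i)) ->
    br (snoc [ffun i => alpha (x i)] (br y)) =
    \sum_(i < n) (-1) ^+ (degtot d && degpre e i) *:
      br (around alpha y i (br (snoc x (y i))))
}.

Section Derivations.
Variables (F : fieldType) (n : nat) (N : nHomLieSuper F n).
Implicit Types (k : nat) (xi : bool) (D : End N).

(* The subspace [N, ..., N]. *)
Definition derived (x : N) : Prop :=
  exists (m : nat) (c : 'I_m -> F) (X : 'I_m -> {ffun 'I_n -> N}),
    x = \sum_(j < m) c j *: br (X j).

Definition dersum k xi (D : N -> N) (d : 'I_n -> bool) (x : {ffun 'I_n -> N}) : N :=
  \sum_(i < n) (-1) ^+ (xi && degpre d i) *: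
    br (around (iter k (@alpha F n N)) x i (D (x i))).

Definition is_der k xi D : Prop :=
  [/\ homog (@gr F n N) xi D,
      forall x, D (alpha N x) = alpha N (D x)
    & forall (x : {ffun 'I_n -> N}) d, (forall i, x i \in gr (d i)) ->
        D (br x) = dersum k xi D d x].

(* D' is associated with the homogeneous alpha^k-quasiderivation D. *)
Definition is_qder k xi D (D' : End N) : Prop :=
  [/\ homog (@gr F n N) xi D, homog (@gr F n N) xi D',
      forall x, D (alpha N x) = alpha N (D x),
      forall x, D' (alpha N x) = alpha N (D' x)
    & forall (x : {ffun 'I_n -> N}) d, (forall i, x i \in gr (d i)) ->
        dersum k xi D d x = D' (br x)].

Definition in_span (P : End N -> Prop) (f : N -> N) : Prop :=
  exists (m : nat) (c : 'I_m -> F) (E : 'I_m -> End N),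
    (forall j, P (E j)) /\ forall x, f x = \sum_(j < m) c j *: E j x.

Definition Der_k k : (N -> N) -> Prop := in_span (fun D => exists xi, is_der k xi D).

Definition Der (f : N -> N) : Prop :=
  exists (m : nat) (E : 'I_m -> End N),
    (forall k : 'I_m, Der_k k (E k)) /\ forall x, f x = \sum_(k < m) E k x.

Definition QDer_k k : (N -> N) -> Prop :=
  in_span (fun D => exists xi D', is_qder k xi D D').

(* D' is associated with the element D of QDer_{alpha^k}(N), not necessarily
   homogeneous: the linear extension of [is_qder]. *)
Definition assoc k D D' : Prop :=
  exists (m : nat) (c : 'I_m -> F) (xi : 'I_m -> bool) (E E' : 'I_m -> End N),
    [/\ forall j, is_qder k (xi j) (E j) (E' j),
        forall x, D x = \sum_(j < m) c j *: E j x
      & forall x, D' x = \sum_(j < m) c j *: E' j x].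

(* The elements of QDer(N) = sum_k QDer_{alpha^k}(N) are the sums
   \sum_(k < m) d k with [QDer_fam d].  The family d has to be remembered: a
   linear map can be both an alpha^k- and an alpha^l-quasiderivation, and the
   maps associated with it on [N, ..., N] are then different for k and for l. *)
Definition QDer_fam m (d : 'I_m -> End N) : Prop := forall k : 'I_m, QDer_k k (d k).

Definition assoc_fam m (d d' : 'I_m -> End N) : Prop :=
  forall k : 'I_m, assoc k (d k) (d' k).

End Derivations.

Section Breve.
Variables (F : fieldType) (n : nat) (N : nHomLieSuper F n).

(* The pair (x, y) stands for x t + y t^n. *)
Let bcar : lmodType F := (N * N)%type.

(* x t^m; the exponents 1 < m < n do not occur in brackets. *)
Definition tmon (m : nat) (x : N) : N * N :=
  if m == 1%N then (x, 0) else if m == n then (0, x) else 0.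

(* A choice j_1, ..., j_n in {1, n} is encoded by J : 'I_n -> bool. *)
Definition texp (b : bool) : nat := if b then n else 1.
Definition tcoef (b : bool) (z : N * N) : N := if b then z.2 else z.1.

(* The multilinear extension of
   [x_1 t^{j_1}, ..., x_n t^{j_n}] = [x_1, ..., x_n] t^{j_1 + ... + j_n}. *)
Definition breve_br (z : {ffun 'I_n -> bcar}) : bcar :=
  \sum_(J : {ffun 'I_n -> bool})
    tmon (\sum_(i < n) texp (J i)) (br [ffun i => tcoef (J i) (z i)]).

Definition breve_gr (b : bool) : {pred bcar} :=
  [pred z : N * N | (z.1 \in gr b) && (z.2 \in gr b)].

Definition breve_alpha (z : bcar) : bcar := (alpha N z.1, alpha N z.2).

Lemma breve_alpha_linear : linear breve_alpha.
Proof. by move=> a [x1 x2] [y1 y2]; rewrite /breve_alpha /= !linearP. Qed.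

HB.instance Definition _ := GRing.isLinear.Build F bcar bcar _ breve_alpha
  breve_alpha_linear.

Lemma br_eq0 (x : {ffun 'I_n -> N}) i : x i = 0 -> br x = 0.
Proof.
move=> xi0; have := br_linear x i (-1) 0 0.
have -> : upd x i (-1 *: 0 + 0) = x.
  by apply/ffunP=> j; rewrite ffunE scaler0 addr0; case: eqP => // ->.
have -> : upd x i 0 = x.
  by apply/ffunP=> j; rewrite ffunE; case: eqP => // ->.
by rewrite scaleN1r addNr.
Qed.

Lemma breve_brE (z : {ffun 'I_n -> bcar}) :
  breve_br z = (0, br [ffun i => (z i).1]).
Proof.
have n2 := arity_ge2 N.
rewrite /breve_br (bigD1 [ffun=> false]) //= [X in _ + X]big1 => [|J nJ].
  rewrite addr0 (eq_bigr (fun=> 1%N)) => [|i _]; last by rewrite ffunE.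
  rewrite sum1_card card_ord /tmon eqxx gtn_eqF //.
  by congr (_, br _); apply/ffunP=> i; rewrite !ffunE.
have [i Ji] : exists i, J i.
  apply/existsP; apply: contraNT nJ; rewrite negb_exists => /forallP h.
  by apply/eqP/ffunP=> i; rewrite ffunE; apply/negbTE.
have : (n < \sum_(i < n) texp (J i))%N.
  rewrite (bigD1 i) //= /texp Ji -[ltnLHS]addn0 ltn_add2l lt0n.
  rewrite sum_nat_eq0 negb_forall; apply/existsP.
  have [j ji] : exists j : 'I_n, j != i.
    apply/existsP; rewrite -negb_forall; apply/negP=> /forallP h.
    have := h (Ordinal (ltnW n2)); have := h (Ordinal n2).
    by move=> /eqP <- /eqP [].
  by exists j; rewrite negb_imply ji /=; case: ifP => _ //; rewrite -lt0n ltnW.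
move=> h; rewrite /tmon !gtn_eqF //; exact: ltn_trans h.
Qed.

Lemma breve_grading : is_grading breve_gr.
Proof.
have [h1 h2 h3] := gr_grading N; split.
- move=> b; have [b0 bl] := h1 b; split; first by rewrite inE /= b0.
  move=> a u v; rewrite !inE => /andP[u1 u2] /andP[v1 v2].
  by rewrite /= !bl.
- move=> [x y]; have [x0 [x1 [hx0 hx1 ->]]] := h2 x.
  have [y0 [y1 [hy0 hy1 ->]]] := h2 y.
  by exists (x0, y0), (x1, y1); rewrite !inE /= hx0 hx1 hy0 hy1.
- move=> [x y]; rewrite !inE /= => /andP[x0 y0] /andP[x1 y1].
  by rewrite (h3 x) // (h3 y).
Qed.

Lemma gr0 b : 0 \in @gr F n N b.
Proof. by have [h _ _] := gr_grading N; have [] := h b. Qed.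

Lemma breve_br_linear (x : {ffun 'I_n -> bcar}) i (a : F) (u v : bcar) :
  breve_br (upd x i (a *: u + v)) =
  a *: breve_br (upd x i u) + breve_br (upd x i v).
Proof.
have E (w : bcar) : [ffun j => (upd x i w j).1] = upd [ffun j => (x j).1] i w.1.
  by apply/ffunP=> j; rewrite !ffunE; case: eqP.
rewrite !breve_brE !E /= br_linear.
by congr (_, _); rewrite /= scaler0 addr0.
Qed.

Lemma breve_alpha_even : homog breve_gr false breve_alpha.
Proof.
by move=> b [x y]; rewrite !inE /= => /andP[hx hy]; rewrite !(@alpha_even F n N b).
Qed.

Lemma breve_br_gr (x : {ffun 'I_n -> bcar}) d :
  (forall i, x i \in breve_gr (d i)) -> breve_br x \in breve_gr (degtot d).
Proof.
move=> h; rewrite breve_brE inE /= gr0 br_gr // => i; rewrite ffunE.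
by have := h i; rewrite inE => /andP[].
Qed.

Lemma breve_br_skew (x : {ffun 'I_n -> bcar}) d (i j : 'I_n) :
  (forall l, x l \in breve_gr (d l)) -> j = i.+1 :> nat ->
  breve_br x = - ((-1) ^+ (d i && d j) *: breve_br (swap x i j)).
Proof.
move=> h ij; rewrite !breve_brE (br_skew (d := d) _ ij); last first.
  by move=> l; rewrite ffunE; have := h l; rewrite inE => /andP[].
congr (_, _); rewrite /= ?scaler0 ?oppr0 //; congr (- (_ *: br _)).
by apply/ffunP=> l; rewrite !ffunE.
Qed.

Lemma breve_alpha_br (x : {ffun 'I_n -> bcar}) :
  breve_alpha (breve_br x) = breve_br [ffun i => breve_alpha (x i)].
Proof.
rewrite !breve_brE /breve_alpha /= linear0 alpha_br; congr (_, br _).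
by apply/ffunP=> i; rewrite !ffunE.
Qed.

Lemma breve_hom_jacobi (x : {ffun 'I_n.-1 -> bcar}) (y : {ffun 'I_n -> bcar})
    (d : 'I_n.-1 -> bool) (e : 'I_n -> bool) :
  (forall i, x i \in breve_gr (d i)) -> (forall i, y i \in breve_gr (e i)) ->
  breve_br (snoc [ffun i => breve_alpha (x i)] (breve_br y)) =
  \sum_(i < n) (-1) ^+ (degtot d && degpre e i) *:
    breve_br (around breve_alpha y i (breve_br (snoc x (y i)))).
Proof.
move=> _ _; have n0 : (n.-1 < n)%N by rewrite prednK // ltnW // (arity_ge2 N).
rewrite big1 => [|i _].
  rewrite breve_brE (@br_eq0 _ (Ordinal n0)) // !ffunE insubF /= ?ltnn //.
  by rewrite breve_brE.
rewrite breve_brE (@br_eq0 _ i); first exact: scaler0.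
by rewrite !ffunE eqxx breve_brE.
Qed.

Definition breve : nHomLieSuper F n :=
  @NHomLieSuper F n bcar breve_gr breve_br breve_alpha (arity_ge2 N)
    breve_grading breve_br_linear breve_alpha_even breve_br_gr breve_br_skew
    breve_alpha_br breve_hom_jacobi.

End Breve.

Section Phi.
Variables (F : fieldType) (n : nat) (N : nHomLieSuper F n) (U : {pred N}).

Definition complement_derived : Prop :=
  (forall x : N, exists u b, [/\ u \in U, derived b & x = u + b]) /\
  (forall x : N, x \in U -> derived x -> x = 0).

(* E (a t + u t^n + b t^n) = D(a) t + D'(b) t^n for D = \sum_k d k and
   D' = \sum_k d' k. *)
Definition phi_formula m (d d' : 'I_m -> End N) (E : End (breve N)) : Prop :=
  forall a u b : N, u \in U -> derived b ->
    E ((a, u + b) : breve N) = (\sum_(k < m) d k a, \sum_(k < m) d' k b).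

Definition is_phi (phi : forall m, ('I_m -> End N) -> End (breve N)) : Prop :=
  forall m (d : 'I_m -> End N), QDer_fam d ->
    exists d' : 'I_m -> End N, assoc_fam d d' /\ phi_formula d d' (phi m d).

End Phi.

(* Main.v *)
Require Import Defs.
From HB Require Import structures.
From mathcomp Require Import all_boot all_order all_algebra.
From Stdlib Require Import ClassicalEpsilon.

Set Implicit Arguments.
Unset Strict Implicit.
Unset Printing Implicit Defensive.
Import GRing.Theory.
Local Open Scope ring_scope.

(** Brackets in [breve N] only see the components in [N t] and only produce
    components in [[N, ..., N] t^n].  So a map acting as [D] on [N t] and as
    [D'] on [[N, ..., N] t^n] satisfies the Leibniz rule on [breve N] exactly
    when [D'] is associated with the quasiderivation [D]: this is
    [lift_is_der], and it gives (3).  The lift [z |-> (D z.1, D' (p z.2))] uses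
    the projection [p] of [N] onto [[N, ..., N]] along [U].  It is homogeneous
    because [p] is even, which holds because [U] and [[N, ..., N]] are both
    graded ([proj_even]), and it commutes with the twisting map because [p] does
    when [U] is stable under [alpha] ([proj_alpha]).

    The remaining point is that [D'] is determined by [D] on [[N, ..., N]]
    ([assoc_unique]).  For homogeneous [D] the defining identity prescribes [D']
    on brackets of homogeneous elements, and by multilinearity these span
    [[N, ..., N]].  In general [D] is a sum of homogeneous quasiderivations;
    collecting the terms of equal degree ([assoc_parts]) leaves an even and an
    odd one, which are determined by [D] ([homog_parts_unique]), and so the
    parts of [D'] are determined on [[N, ..., N]] as well.  This is the
    independence claim of (2); applied to a homogeneous [D], whose part of the
    other degree is zero, it shows that [D'] has the degree of [D] on
    [[N, ..., N]], which gives (1).  Injectivity is read off from the component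
    in [N t], where phi(D) is [D] itself. *)

(** * Linear maps on graded spaces *)

Section GradedSpaces.
Variables (F : fieldType) (V : lmodType F).
Implicit Types (gr : bool -> {pred V}) (S : {pred V}).

(** The predicate [P] serves to collect the terms of one given degree. *)
Definition lincomb m (P : pred 'I_m) (c : 'I_m -> F) (E : 'I_m -> End V)
  (x : V) : V := \sum_(j < m | P j) c j *: E j x.

Lemma lincomb_linear m P c (E : 'I_m -> End V) : linear (lincomb P c E).
Proof.
move=> a u v; rewrite /lincomb scaler_sumr -big_split /=.
by apply: eq_bigr => j _; rewrite linearP scalerDr !scalerA mulrC.
Qed.

HB.instance Definition _ m P c (E : 'I_m -> End V) :=
  GRing.isLinear.Build F V V *:%R (lincomb P c E) (lincomb_linear P c E).

Lemma submod_sum S m (P : pred 'I_m) (c : 'I_m -> F) (v : 'I_m -> V) :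
  submod_closed S -> (forall j, P j -> v j \in S) ->
  \sum_(j < m | P j) c j *: v j \in S.
Proof.
by move=> [S0 Slin] vS; elim/big_rec: _ => // j w Pj wS; apply: Slin; rewrite ?vS.
Qed.

Lemma submodD S u v : submod_closed S -> u \in S -> v \in S -> u + v \in S.
Proof. by move=> [_ Slin] uS vS; rewrite -[u]scale1r Slin. Qed.

Lemma submodB S u v : submod_closed S -> u \in S -> v \in S -> u - v \in S.
Proof. by move=> [_ Slin] uS vS; rewrite addrC -scaleN1r Slin. Qed.

Lemma grading_disjoint gr b x :
  is_grading gr -> x \in gr b -> x \in gr (~~ b) -> x = 0.
Proof. by move=> [_ _ h]; case: b => /= hx hx'; apply: h. Qed.

Lemma linear_eq_homog gr (f g : End V) : is_grading gr ->
  (forall b x, x \in gr b -> f x = g x) -> f =1 g.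
Proof.
move=> [_ dec _] fg x; have [x0 [x1 [h0 h1 ->]]] := dec x.
by rewrite !linearD (fg false) ?(fg true).
Qed.

Lemma homog_lincomb gr xi m (P : pred 'I_m) c (E : 'I_m -> End V) :
  is_grading gr -> (forall j, P j -> homog gr xi (E j)) ->
  homog gr xi (lincomb P c E).
Proof.
move=> [sub _ _] hE b x xb; apply: submod_sum => // j Pj; exact: hE xb.
Qed.

(** On an argument of degree [b] the summands have the distinct degrees
    [xi + b] and [xi + b + 1], so a sum of an even and an odd map determines
    both of them. *)
Lemma homog_parts_unique gr (C E : bool -> End V) : is_grading gr ->
  (forall xi, homog gr xi (C xi)) -> (forall xi, homog gr xi (E xi)) ->
  (forall x, C false x + C true x = E false x + E true x) ->
  forall xi, C xi =1 E xi.
Proof.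
move=> grP hC hE CE xi; apply: (linear_eq_homog grP) => b x xb.
have [sub _ _] := grP.
have CE' : C xi x - E xi x = E (~~ xi) x - C (~~ xi) x.
  have trade (p q r s : V) : p + q = r + s -> p - r = s - q.
    move=> e; apply/eqP; rewrite subr_eq addrAC [s + r]addrC -e.
    by rewrite addrK.
  by apply: trade; case: xi => /=; rewrite ?CE // addrC CE addrC.
apply/eqP; rewrite -subr_eq0; apply/eqP.
apply: (grading_disjoint grP (b := xi (+) b)).
  by apply: submodB => //; [apply: hC | apply: hE].
by rewrite CE' -addNb; apply: submodB => //; [apply: hE | apply: hC].
Qed.

End GradedSpaces.

(** * Brackets and the derived subspace *)

Section Brackets.
Variables (F : fieldType) (n : nat) (N : nHomLieSuper F n).
Implicit Types (D : End N) (U : {pred N}).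

Let grN := gr_grading N.

Lemma br_upd_lincomb (x : {ffun 'I_n -> N}) i m (P : pred 'I_m) (c : 'I_m -> F)
    (v : 'I_m -> N) :
  br (upd x i (\sum_(j < m | P j) c j *: v j)) =
  \sum_(j < m | P j) c j *: br (upd x i (v j)).
Proof.
elim/big_rec2: _ => [|j w1 w2 _ <-]; last by rewrite br_linear.
by apply: (@br_eq0 _ _ _ _ i); rewrite ffunE eqxx.
Qed.

(** Multilinearity: splitting one argument after the other into its two
    homogeneous parts turns an arbitrary bracket into a sum of brackets of
    homogeneous elements. *)
Lemma br_homog_ind (P : N -> Prop) :
  (forall u v, P u -> P v -> P (u + v)) ->
  (forall (x : {ffun 'I_n -> N}) d, (forall i, x i \in gr (d i)) -> P (br x)) ->
  forall x, P (br x).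
Proof.
move=> PD Phomog x.
(* The number [m] of leading arguments that may be inhomogeneous goes down. *)
suff main m (y : {ffun 'I_n -> N}) :
    (forall i : 'I_n, (m <= i)%N -> exists b, y i \in gr b) -> P (br y).
  by apply: (main n) => i; rewrite leqNgt ltn_ord.
elim: m y => [|m IHm] y hy.
  have [d hd] := fin_all_exists (fun i => hy i (leq0n i)).
  exact: (Phomog _ d).
have [ltmn|lenm] := ltnP m n; last first.
  by apply: IHm => i /(leq_trans lenm); rewrite leqNgt ltn_ord.
pose i0 := Ordinal ltmn.
have [_ dec _] := grN; have [y0 [y1 [h0 h1 yE]]] := dec (y i0).
have -> : y = upd y i0 (1 *: y0 + y1).
  by apply/ffunP=> j; rewrite ffunE scale1r -yE; case: eqP => // ->.
have hupd z b : z \in gr b -> P (br (upd y i0 z)).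
  move=> zb; apply: IHm => i; rewrite ffunE.
  have [_ _|ne lei] := eqVneq; first by exists b.
  by apply: hy; rewrite ltn_neqAle lei andbT eq_sym.
by rewrite br_linear scale1r; apply: PD; [apply: hupd h0 | apply: hupd h1].
Qed.

Lemma derived_br (x : {ffun 'I_n -> N}) : derived (br x).
Proof. by exists 1%N, (fun=> 1), (fun=> x); rewrite big_ord1 scale1r. Qed.

Lemma derived0 : derived (0 : N).
Proof.
exists 0%N, (fun=> 0), (fun=> [ffun=> 0]); by rewrite big_ord0.
Qed.

Lemma derived_lin a (u v : N) : derived u -> derived v -> derived (a *: u + v).
Proof.
move=> [m1 [c1 [X1 ->]]] [m2 [c2 [X2 ->]]].
exists (m1 + m2)%N,
  (fun j => match split j with inl i => a * c1 i | inr i => c2 i end),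
  (fun j => match split j with inl i => X1 i | inr i => X2 i end).
rewrite big_split_ord scaler_sumr; congr (_ + _); apply: eq_bigr => j _.
  by rewrite (unsplitK (inl j)) scalerA.
by rewrite (unsplitK (inr j)).
Qed.

Lemma derivedB (u v : N) : derived u -> derived v -> derived (u - v).
Proof. by move=> hu hv; rewrite addrC -scaleN1r; apply: derived_lin. Qed.

(** The derived subspace is already spanned by the brackets of homogeneous
    elements, the only ones for which the axioms with signs say anything. *)
Lemma derived_ind (P : N -> Prop) :
  P 0 -> (forall a u v, P u -> P v -> P (a *: u + v)) ->
  (forall (x : {ffun 'I_n -> N}) d, (forall i, x i \in gr (d i)) -> P (br x)) ->
  forall b, derived b -> P b.
Proof.
move=> P0 Plin Phomog b [m [c [X ->]]].
elim/big_rec: _ => // j v _; apply: (Plin); apply: br_homog_ind => // u w hu hw.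
by rewrite -[u]scale1r; apply: Plin.
Qed.

Lemma derived_alpha (b : N) : derived b -> derived (alpha N b).
Proof.
move: b; apply: derived_ind => [|a u v hu hv|x d _].
- by rewrite linear0; apply: derived0.
- by rewrite linearP; apply: derived_lin.
- by rewrite alpha_br; apply: derived_br.
Qed.

(** The parts of an element are indexed by their degree, so that arguments can
    be made for both degrees at once. *)
Definition homog_parts (W : N -> Prop) (x : N) (y : bool -> N) : Prop :=
  (forall b, y b \in gr b /\ W (y b)) /\ (forall b, x = y b + y (~~ b)).

Lemma homog_partsI (W : N -> Prop) x0 x1 :
  x0 \in gr false -> x1 \in gr true -> W x0 -> W x1 ->
  exists y, homog_parts W (x0 + x1) y.
Proof.
move=> *; exists (fun b => if b then x1 else x0).
by split=> -[] //=; rewrite addrC.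
Qed.

(** The derived subspace is graded, since it is spanned by the brackets of
    homogeneous elements and these are homogeneous. *)
Lemma derived_homog_parts (b : N) :
  derived b -> exists y, homog_parts (@derived F n N) b y.
Proof.
have [sub _ _] := grN; have z b' : 0 \in @gr F n N b' by apply: gr0.
move: b; apply: derived_ind => [|a u v [yu [hu uE]] [yv [hv vE]]|x d hx].
- exists (fun=> 0); split=> b; last by rewrite addr0.
  by split; [apply: z | apply: derived0].
- exists (fun b => a *: yu b + yv b); split=> b.
    have [gu du] := hu b; have [gv dv] := hv b; have [_ lin] := sub b.
    by split; [apply: lin | apply: derived_lin].
  by rewrite addrACA -scalerDr -uE -vE.
- have gx := br_gr hx; exists (fun b => if b == degtot d then br x else 0).
  split=> b; last first.
    by rewrite eqb_negLR; case: eqP => [->|/eqP]; rewrite ?eqxx;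
      case: b; case: (degtot d); rewrite //= ?addr0 ?add0r.
  by case: eqP => [->|_]; split=> //; [apply: derived_br | apply: derived0].
Qed.

(** * Quasiderivations and the maps associated with them *)

Lemma around_upd (f : N -> N) (x : {ffun 'I_n -> N}) i v :
  around f x i v = upd (around f x i 0) i v.
Proof. by apply/ffunP=> j; rewrite !ffunE; case: eqP. Qed.

Lemma dersum_lincomb k xi m (P : pred 'I_m) c (E : 'I_m -> End N) d x :
  dersum k xi (lincomb P c E) d x =
  \sum_(j < m | P j) c j *: dersum k xi (E j) d x.
Proof.
rewrite /dersum; under [RHS]eq_bigr do rewrite scaler_sumr.
rewrite exchange_big; apply: eq_bigr => i _ /=.
rewrite around_upd br_upd_lincomb scaler_sumr; apply: eq_bigr => j _.
by rewrite -around_upd !scalerA mulrC.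
Qed.

Lemma is_qder_lincomb k xi m (P : pred 'I_m) c (E E' : 'I_m -> End N) :
  (forall j, P j -> is_qder k xi (E j) (E' j)) ->
  is_qder k xi (lincomb P c E) (lincomb P c E').
Proof.
move=> hE; split.
- by apply: homog_lincomb => // j /hE[].
- by apply: homog_lincomb => // j /hE[].
- move=> x; rewrite /= /lincomb linear_sum; apply: eq_bigr => j /hE[_ _ EC _ _].
  by rewrite EC linearZ.
- move=> x; rewrite /= /lincomb linear_sum; apply: eq_bigr => j /hE[_ _ _ EC _].
  by rewrite EC linearZ.
- move=> x d hx; rewrite dersum_lincomb; apply: eq_bigr => j /hE[_ _ _ _ ED].
  by rewrite (ED x d hx).
Qed.

Lemma is_qder_unique k xi (D D' E E' : End N) b :
  is_qder k xi D D' -> is_qder k xi E E' -> D =1 E -> derived b -> D' b = E' b.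
Proof.
move=> [_ _ _ _ hD] [_ _ _ _ hE] DE; move: b.
apply: derived_ind => [|a u v|x d hx]; first by rewrite !linear0.
  by rewrite !linearP => -> ->.
rewrite -(hD x d hx) -(hE x d hx); apply: eq_bigr => i _.
by rewrite DE.
Qed.

(** Collecting the terms of each degree replaces a sum of homogeneous
    quasiderivations by one of degree 0 and one of degree 1. *)
Lemma assoc_parts k (D D' : End N) : assoc k D D' ->
  exists C C' : bool -> End N,
    [/\ forall xi, is_qder k xi (C xi) (C' xi),
        forall x, D x = C false x + C true x
      & forall x, D' x = C' false x + C' true x].
Proof.
move=> [m [c [xi [E [E' [hE DE D'E]]]]]].
exists (fun b => lincomb (fun j => xi j == b) c E),
  (fun b => lincomb (fun j => xi j == b) c E'); split.
- by move=> b; apply: is_qder_lincomb => j /eqP <-.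
- by move=> x; rewrite DE (bigID (fun j => xi j == false)); congr (_ + _);
    apply: eq_bigl => j; case: (xi j).
- by move=> x; rewrite D'E (bigID (fun j => xi j == false)); congr (_ + _);
    apply: eq_bigl => j; case: (xi j).
Qed.

(** On homogeneous arguments [D'] is prescribed on brackets by the parts of
    [D], and these are determined by [D]. *)
Lemma assoc_unique k (D D' D'' : End N) b :
  assoc k D D' -> assoc k D D'' -> derived b -> D' b = D'' b.
Proof.
move=> /assoc_parts[C [C' [hC DC D'C]]] /assoc_parts[E [E' [hE DE D''E]]] db.
have CE xi : C xi =1 E xi.
  apply: (homog_parts_unique grN) => [z|z|x]; last by rewrite -DC -DE.
  - by have [] := hC z.
  - by have [] := hE z.
by rewrite D'C D''E; congr (_ + _); apply: is_qder_unique (hC _) (hE _) _ db.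
Qed.

(** If [D] has degree [xi], its part of the other degree is zero, and so is the
    associated map of that part on the derived subspace.  Outside of the derived
    subspace [D'] may be inhomogeneous. *)
Lemma assoc_homog k xi (D D' : End N) b e :
  assoc k D D' -> homog (@gr F n N) xi D -> derived b -> b \in gr e ->
  D' b \in gr (xi (+) e).
Proof.
move=> /assoc_parts[C [C' [hC DC D'C]]] hD db be.
(* The homogeneous parts of [D] itself. *)
pose Z : bool -> End N := fun z => if z == xi then D else \0.
have hz z : homog (@gr F n N) z \0 by move=> a x _; apply: gr0.
have CZ z : C z =1 Z z.
  apply: (homog_parts_unique grN) => [y|y|x]; first by have [] := hC y.
    by rewrite /Z; case: eqP => [->|_].
  by rewrite -DC /Z; case: (xi); rewrite /= ?addr0 ?add0r.
have C'0 : C' (~~ xi) b = 0.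
  have q0 : is_qder k (~~ xi) (\0 : End N) (\0 : End N).
    split=> //; try by move=> x; rewrite linear0.
    move=> x d _; rewrite /dersum big1 // => i _.
    by rewrite (@br_eq0 _ _ _ _ i) ?scaler0 // ffunE eqxx.
  apply: (is_qder_unique (hC _) q0 _ db) => x.
  by rewrite CZ /Z; case: (xi).
have -> : D' b = C' xi b.
  by rewrite D'C; case: (xi) C'0 => /= ->; rewrite ?addr0 ?add0r.
by have [_ h _ _ _] := hC xi; apply: h.
Qed.

Lemma QDer_assoc k D : QDer_k k D -> exists D' : End N, assoc k D D'.
Proof.
move=> [m [c [E [hE DE]]]].
have [xi hxi] := fin_all_exists hE.
have [E' hE'] := fin_all_exists hxi.
exists (lincomb predT c E'), m, c, xi, E, E'; split=> // x.
Qed.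

(** * The projection onto the derived subspace *)

Definition derived_proj U (p : N -> N) : Prop :=
  forall u b, u \in U -> derived b -> p (u + b) = b.

Section Projection.
Variables (U : {pred N}) (U_gr : graded_subspace (@gr F n N) U).
Hypothesis U_compl : complement_derived U.

(** The component in the derived subspace is chosen pointwise; directness of
    the sum makes the choice unique, hence linear. *)
Lemma exists_derived_proj : exists p : End N, derived_proj U p.
Proof.
have [[U0 Ulin] _] := U_gr; have [dec disj] := U_compl.
have decb x : exists b, derived b /\ x - b \in U.
  by have [u [b [uU db ->]]] := dec x; exists b; rewrite addrK.
have [p hp] := choice _ decb.
have pP u b : u \in U -> derived b -> p (u + b) = b.
  move=> uU db; have [dp pU] := hp (u + b).
  apply/eqP; rewrite eq_sym -subr_eq0; apply/eqP/disj; last exact: derivedB.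
  have -> : b - p (u + b) = (u + b - p (u + b)) - u.
    by rewrite [u + b]addrC [b + u - _]addrAC addrK.
  by apply: (submodB (proj1 U_gr)).
have plin : linear p.
  move=> a x y; have [dx xU] := hp x; have [dy yU] := hp y.
  rewrite -[in LHS](subrK (p x) x) -[in LHS](subrK (p y) y).
  rewrite scalerDr addrACA pP //; first exact: Ulin.
  exact: derived_lin.
pose L := GRing.isLinear.Build F N N *:%R p plin.
by exists (HB.pack p L : End N).
Qed.

Variables (p : End N) (pP : derived_proj U p).

Lemma proj_derived b : derived b -> p b = b.
Proof. by have [[U0 _] _] := U_gr; rewrite -[in LHS](add0r b); apply: pP. Qed.

(** In a decomposition [w = u + b] of an element of degree [e], the parts of
    degree [e + 1] of [u] and [b] cancel, hence they vanish. *)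
Lemma proj_even : homog (@gr F n N) false p.
Proof.
have [sub _ _] := grN; have [[U0 Ulin] Udec] := U_gr.
have [dec disj] := U_compl.
move=> e w we; have [u [b [uU db wE]]] := dec w.
have [u0 [u1 [hu0 hu1 u0U u1U uE]]] := Udec u uU.
have [yu [hu yuE]] := homog_partsI (W := fun x => x \in U) hu0 hu1 u0U u1U.
rewrite -uE in yuE.
have [yb [hb ybE]] := derived_homog_parts db.
have [gu _] := hu e; have [gu' uU'] := hu (~~ e).
have [gb _] := hb e; have [gb' db'] := hb (~~ e).
have cancel : yu (~~ e) + yb (~~ e) = 0.
  apply: (grading_disjoint grN (b := e)); last exact: submodD.
  have -> : yu (~~ e) + yb (~~ e) = w - (yu e + yb e).
    by rewrite wE (yuE e) (ybE e) addrACA [RHS]addrC addKr.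
  by apply: submodB => //; apply: submodD.
have b0 : yb (~~ e) = 0.
  apply: disj => //; have -> : yb (~~ e) = 0 - yu (~~ e).
    by rewrite -cancel addrAC subrr add0r.
  by apply: (submodB (proj1 U_gr)).
by rewrite wE pP // (ybE e) b0 addr0.
Qed.

Lemma proj_alpha : (forall u : N, u \in U -> alpha N u \in U) ->
  forall x, p (alpha N x) = alpha N (p x).
Proof.
move=> alphaU x; have [dec _] := U_compl; have [u [b [uU db ->]]] := dec x.
by rewrite linearD !pP //; [apply: alphaU | apply: derived_alpha].
Qed.

(** * The lift of a quasiderivation *)

Definition lift (D D' : End N) (z : breve N) : breve N := (D z.1, D' (p z.2)).

Lemma lift_linear D D' : linear (lift D D').
Proof. by move=> a u v; rewrite /lift /= !linearP. Qed.

HB.instance Definition _ D D' :=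
  GRing.isLinear.Build F (breve N) (breve N) *:%R (lift D D') (lift_linear D D').

Lemma br_breveE (z : {ffun 'I_n -> breve N}) :
  br z = (0, br [ffun i => (z i).1]) :> breve N.
Proof. exact: breve_brE. Qed.

Lemma iter_breve_alpha k (z : breve N) :
  (iter k (alpha (breve N)) z).1 = iter k (alpha N) z.1.
Proof. by elim: k => //= k ->. Qed.

(** Brackets of [breve N] have the form [(0, b)] with [b] the bracket of the
    first components. There [p] is the identity and the lift acts as [D'],
    so the Leibniz rule for the lift is the quasiderivation identity. *)
Lemma lift_is_der k xi D D' : (forall u : N, u \in U -> alpha N u \in U) ->
  is_qder k xi D D' -> is_der k xi (lift D D' : End (breve N)).
Proof.
move=> alphaU [hD hD' DC D'C hder]; split.
- move=> b z; rewrite !inE /= => /andP[z1 z2]; rewrite hD //=.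
  by apply: hD'; apply: proj_even z2.
- by move=> z; rewrite /= /lift /= DC proj_alpha // D'C.
- move=> z d hz; rewrite br_breveE /= /lift /= linear0 proj_derived; last first.
    exact: derived_br.
  rewrite -(hder _ d); last first.
    by move=> i; rewrite ffunE; have := hz i; rewrite inE => /andP[].
  rewrite /dersum; elim/big_rec2: _ => // i w1 w2 _ <-.
  rewrite br_breveE; congr (_, _); first by rewrite /= scaler0 addr0.
  congr (_ *: br _ + _); apply/ffunP=> j; rewrite !ffunE; case: eqP => // _.
  by rewrite iter_breve_alpha.
Qed.

Lemma lift_Der_k k D D' : (forall u : N, u \in U -> alpha N u \in U) ->
  assoc k D D' -> Der_k k (lift D D').
Proof.
move=> alphaU /assoc_parts[C [C' [hC DC D'C]]].
exists 2%N, (fun=> 1), (fun j => lift (C (j == 1)) (C' (j == 1)) : End (breve N)).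
split=> [j|z]; first by exists (j == 1); apply: lift_is_der.
by rewrite big_ord_recl big_ord1 !scale1r /= /lift DC D'C.
Qed.

End Projection.

(** * The map phi *)

(** For each family of quasiderivations associated maps exist, and lifting
    their sum along a projection gives a suitable value; the function phi itself
    comes from the axiom of choice. *)
Lemma exists_phi U : graded_subspace (@gr F n N) U -> complement_derived U ->
  exists phi : forall m, ('I_m -> End N) -> End (breve N), is_phi U phi.
Proof.
move=> Ugr Ucompl; have [p pP] := exists_derived_proj Ugr Ucompl.
pose good m (d : 'I_m -> End N) (E : End (breve N)) :=
  exists d' : 'I_m -> End N, assoc_fam d d' /\ phi_formula U d d' E.
exists (fun m d => epsilon (inhabits (\0 : End (breve N))) (good m d)).
move=> m d hd; apply: (@epsilon_spec _ _ (good m d)).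
have [d' hd'] := fin_all_exists (fun k => QDer_assoc (hd k)).
pose total (f : 'I_m -> End N) : End N := lincomb predT (fun=> 1) f.
exists (lift p (total d) (total d')), d'; split=> // a u b uU db.
rewrite /= /lift /= /lincomb pP //.
by congr (_, _); apply: eq_bigr => k _; rewrite scale1r.
Qed.

End Brackets.

Lemma sum_pair (V W : nmodType) m (f : 'I_m -> V) (g : 'I_m -> W) :
  \sum_(k < m) (f k, g k) = (\sum_(k < m) f k, \sum_(k < m) g k).
Proof. by elim/big_rec3: _ => // k x y z _ ->. Qed.

Theorem proposition4p2 (F : fieldType) (n : nat) (N : nHomLieSuper F n)
    (U : {pred N}) :
  [pchar F] =i pred0 ->
  graded_subspace (@gr F n N) U ->
  complement_derived U ->
  (exists phi : forall m, ('I_m -> End N) -> End (breve N), is_phi U phi) /\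
  forall phi : forall m, ('I_m -> End N) -> End (breve N), is_phi U phi ->
  [/\ (* (1) *)
      forall m (d : 'I_m -> End N) (xi : bool), QDer_fam d ->
        (forall k, homog (@gr F n N) xi (d k)) ->
        homog (@gr F n (breve N)) xi (phi m d),
      (* (2), injectivity *)
      forall m p (d : 'I_m -> End N) (e : 'I_p -> End N),
        QDer_fam d -> QDer_fam e -> phi m d =1 phi p e ->
        forall x : N, \sum_(k < m) d k x = \sum_(k < p) e k x,
      (* (2), independence of the choice of D' *)
      forall m (d d' : 'I_m -> End N), QDer_fam d -> assoc_fam d d' ->
        phi_formula U d d' (phi m d)
    & (* (3); alpha(U) <= U is needed for phi(D) to commute with breve alpha *)
      (forall u : N, u \in U -> alpha N u \in U) ->
      forall m (d : 'I_m -> End N), QDer_fam d -> Der (phi m d)].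
Proof.
move=> _ Ugr Ucompl; split; first exact: exists_phi.
move=> phi phiP; have [[U0 _] _] := Ugr; have [dec _] := Ucompl.
have [p pP] := exists_derived_proj Ugr Ucompl.
have [sub _ _] := gr_grading N.
split.
- move=> m d xi hd dxi b [a w]; rewrite inE /= => /andP[ga gw].
  have [d' [hd' phiE]] := phiP m d hd; have [u [v [uU dv wE]]] := dec w.
  have gv : v \in gr b.
    by rewrite -(pP _ _ uU dv) -wE; apply: (proj_even Ugr Ucompl pP).
  rewrite wE phiE // inE /=; apply/andP; split.
    under eq_bigr do rewrite -[d _ a]scale1r.
    by apply: submod_sum => // k _; apply: dxi.
  under eq_bigr do rewrite -[d' _ v]scale1r.
  by apply: submod_sum => // k _; apply: assoc_homog (hd' k) (dxi k) dv gv.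
- move=> m q d e hd he phi_eq x.
  have [d' [_ phid]] := phiP m d hd; have [e' [_ phie]] := phiP q e he.
  (* [0 + 0] is the decomposition of the second component that the formula
     for phi refers to. *)
  have := phi_eq ((x, 0 + 0) : breve N).
  by rewrite (phid x 0 0) ?(phie x 0 0) //; try apply: derived0; case.
- move=> m d d' hd hd' a u b uU db; have [d'' [hd'' phid]] := phiP m d hd.
  rewrite phid //; congr (_, _); apply: eq_bigr => k _.
  exact: assoc_unique (hd'' k) (hd' k) db.
- move=> alphaU m d hd; have [d' [hd' phid]] := phiP m d hd.
  exists m, (fun k => lift p (d k) (d' k) : End (breve N)); split.
    by move=> k; apply: (lift_Der_k Ugr Ucompl pP alphaU (hd' k)).
  move=> [a w]; have [u [b [uU db ->]]] := dec w.
  rewrite phid // -sum_pair; apply: eq_bigr => k _.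
  by rewrite /= /lift /= pP.
Qed.
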